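(* Let $(Q,c)\in\mathcal{S}^n\times\mathbb{R}^n$. (i) If $Q\succeq0$, then $\ell_{RS}(\hat x)=q(\hat x)$ for each $\hat x\in F$. (ii) For any local or global minimizer $\hat x\in F$ of (BoxQP), we have $\ell_{RS}(\hat x)=q(\hat x)$.
   Context: Let $n \ge 1$, let $\mathcal{S}^n$ be the space of real symmetric $n\times n$ matrices, $e \in \mathbb{R}^n$ the all-ones vector, $\langle A,B\rangle = \mathrm{trace}(A^TB)$; $A\succeq0$ means positive semidefinite. Let $q(x)=\frac12x^TQx+c^Tx$ and $F = \{x \in \mathbb{R}^n : 0 \le x \le e\}$ (componentwise); (BoxQP) is the problem $\min_{x\in F}q(x)$. Let $$\mathcal{F}_R = \{(x,X)\in\mathbb{R}^n\times\mathcal{S}^n : 0\le x\le e,\ \max\{x_i+x_j-1,0\}\le X_{ij}\le \min\{x_i,x_j\},\ 1\le i\le j\le n\}$$ and $\mathcal{F}_{RS}=\{(x,X)\in\mathcal{F}_R:X-xx^T\succeq0\}$. For $\hat x\in F$, $\ell_{RS}(\hat x)=\min\{\frac12\langle Q,X\rangle+c^T\hat x : X\in\mathcal{S}^n,\ (\hat x,X)\in\mathcal{F}_{RS}\}$. *)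

(* Defs.v *)
From HB Require Import structures.
From mathcomp Require Import all_boot all_order all_algebra.
From mathcomp Require Import all_classical all_reals all_analysis.
From mathcomp Require Import ring.

Set Implicit Arguments.
Unset Strict Implicit.
Unset Printing Implicit Defensive.

Import Order.TTheory GRing.Theory Num.Theory.
Import numFieldNormedType.Exports.
Local Open Scope classical_set_scope.
Local Open Scope ring_scope.

Definition psd (R : realType) (n : nat) (A : 'M[R]_n) : Prop :=
  A \is symmetricmx /\ forall v : 'cV[R]_n, 0 <= (v^T *m A *m v) 0 0.

Definition frob (R : realType) (m n : nat) (A B : 'M[R]_(m, n)) : R :=
  \tr (A^T *m B).

Definition q (R : realType) (n : nat) (Q : 'M[R]_n) (c x : 'cV[R]_n) : R :=
  2^-1 * (x^T *m Q *m x) 0 0 + (c^T *m x) 0 0.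

Definition F (R : realType) (n : nat) : set 'cV[R]_n :=
  [set x | forall i, 0 <= x i 0 <= 1].

Definition boxqp_global_min (R : realType) (n : nat) (Q : 'M[R]_n)
    (c xhat : 'cV[R]_n) : Prop :=
  F xhat /\ forall x, F x -> q Q c xhat <= q Q c x.

(* [nbhs] on column vectors is the sup-norm, i.e. the usual Euclidean, topology. *)
Definition boxqp_local_min (R : realType) (n : nat) (Q : 'M[R]_n)
    (c xhat : 'cV[R]_n) : Prop :=
  F xhat /\ \forall x \near within (@F R n) (nbhs xhat), q Q c xhat <= q Q c x.

Definition F_R (R : realType) (n : nat) : set ('cV[R]_n * 'M[R]_n) :=
  [set p | let: (x, X) := p in
    [/\ X \is symmetricmx, F x &
      forall i j : 'I_n, (i <= j)%N ->
        Num.max (x i 0 + x j 0 - 1) 0 <= X i j <= Num.min (x i 0) (x j 0)]].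

Definition F_RS (R : realType) (n : nat) : set ('cV[R]_n * 'M[R]_n) :=
  [set p | F_R p /\ psd (p.2 - p.1 *m p.1^T)].

Definition RS_obj (R : realType) (n : nat) (Q : 'M[R]_n) (c x : 'cV[R]_n)
    (X : 'M[R]_n) : R :=
  2^-1 * frob Q X + (c^T *m x) 0 0.

(* The infimum is attained for every [xhat] in [F], see [ell_RS_min]. *)
Definition ell_RS (R : realType) (n : nat) (Q : 'M[R]_n)
    (c xhat : 'cV[R]_n) : R :=
  inf [set RS_obj Q c xhat X | X in [set X | F_RS (xhat, X)]].

Section ell_RS_attained.
Variables (R : realType) (n : nat).
Implicit Types (x c : 'cV[R]_n) (Q X : 'M[R]_n).

Lemma continuous_affine (T : topologicalType) (I : finType) (a : I -> R)
    (g : I -> T -> R) (b : R) (f : T -> R) :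
  (forall i, continuous (g i)) ->
  (forall t, f t = \sum_i a i * g i t + b) -> continuous f.
Proof.
move=> cg fE; rewrite (_ : f = fun t => \sum_i a i * g i t + b); last exact/funext.
have cs : continuous (fun t => \sum_i a i * g i t).
  apply: continuous_big; first exact: add_continuous.
  move=> i _ t; apply: (@continuousM _ _ (fun=> a i) (g i)); last exact: cg.
  exact: cst_continuous.
move=> t; apply: continuousD; first exact: cs.
exact: cst_continuous.
Qed.

Lemma closed_ge_fun (T : topologicalType) (f : T -> R) a :
  continuous f -> closed [set t | a <= f t].
Proof.
by move=> cf; apply: (@preimage_closed _ _ f [set y | a <= y]) => // t _; exact: cf.
Qed.

Lemma closed_le_fun (T : topologicalType) (f : T -> R) a :
  continuous f -> closed [set t | f t <= a].
Proof.
by move=> cf; apply: (@preimage_closed _ _ f [set y | y <= a]) => // t _; exact: cf.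
Qed.

Lemma symmetricmxP X : reflect (forall i j, X i j = X j i) (X \is symmetricmx).
Proof.
rewrite qualifE /= expr0 scale1r.
apply: (iffP eqP) => [h i j | h]; first by rewrite {1}h !mxE.
by apply/matrixP => i j; rewrite !mxE.
Qed.

Lemma F_RS_outer x : F x -> F_RS (x, x *m x^T).
Proof.
move=> Fx; split; [split => //|].
- by apply/symmetricmxP => i j; rewrite !mxE !big_ord1 !mxE mulrC.
- move=> i j _; rewrite !mxE big_ord1 !mxE.
  have /andP[xi0 xi1] := Fx i; have /andP[xj0 xj1] := Fx j.
  rewrite ge_max le_min mulr_ge0// ler_piMr// ler_piMl// !andbT.
  have -> : x i 0 + x j 0 - 1 = x i 0 * x j 0 - (1 - x i 0) * (1 - x j 0).
    by ring.
  by rewrite gerBl mulr_ge0// subr_ge0.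
- rewrite /= subrr; split; first by apply/symmetricmxP => i j; rewrite !mxE.
  by move=> v; rewrite mulmx0 mul0mx mxE.
Qed.

Lemma ell_RS_min Q c x : F x -> exists2 X, F_RS (x, X) &
  RS_obj Q c x X = ell_RS Q c x /\
  forall Y, F_RS (x, Y) -> ell_RS Q c x <= RS_obj Q c x Y.
Proof.
move=> Fx.
pose A := [set v : 'rV[R]_(n * n) | F_RS (x, vec_mx v)].
pose f v := RS_obj Q c x (vec_mx v).
have cX i j : continuous (fun v : 'rV[R]_(n * n) => vec_mx v i j).
  rewrite [X in continuous X](_ : _ = fun v : 'rV_ _ => v 0 (mxvec_index i j)).
    exact: coord_continuous.
  by apply/funext => v; rewrite mxE.
have cquad (u : 'cV[R]_n) : continuous (fun v : 'rV[R]_(n * n) =>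
    (u^T *m (vec_mx v - x *m x^T) *m u) 0 0).
  apply: (@continuous_affine _ _ (fun p : 'I_n * 'I_n => u p.2 0 * u p.1 0)
    (fun p v => vec_mx v p.2 p.1) (- (u^T *m (x *m x^T) *m u) 0 0)).
    by move=> p; exact: cX.
  move=> v; rewrite mulmxBr mulmxBl mxE [in X in _ + X]mxE; congr (_ + _).
  rewrite -(pair_bigA _ (fun j i => u i 0 * u j 0 * vec_mx v i j)) /= mxE.
  apply: eq_bigr => j _; rewrite mxE big_distrl; apply: eq_bigr => i _ /=.
  by rewrite [u^T _ _]mxE mulrAC.
have cf : continuous f.
  apply: (@continuous_affine _ _ (fun p : 'I_n * 'I_n => 2^-1 * Q p.2 p.1)
    (fun p v => vec_mx v p.2 p.1) ((c^T *m x) 0 0)).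
    by move=> p; exact: cX.
  move=> v; congr (_ + _); rewrite /frob /mxtrace big_distrr /=.
  rewrite -(pair_bigA _ (fun j i => 2^-1 * Q i j * vec_mx v i j)) /=.
  apply: eq_bigr => j _; rewrite mxE big_distrr; apply: eq_bigr => i _ /=.
  by rewrite [Q^T _ _]mxE mulrA.
have Asym v : A v -> forall i j, vec_mx v i j = vec_mx v j i.
  by move=> [[/symmetricmxP sX _ _] _].
have cA : closed A.
  have c1 : closed (\bigcap_(ij in [set: 'I_n * 'I_n])
      [set v : 'rV[R]_(n * n) |
        0 <= vec_mx v ij.1 ij.2 - vec_mx v ij.2 ij.1]).
    apply: closed_bigI => -[i j] _; apply: closed_ge_fun => v /=.
    by apply: continuousB; exact: cX.
  have c2 : closed (\bigcap_(ij in [set ij : 'I_n * 'I_n | (ij.1 <= ij.2)%N])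
      ([set v : 'rV[R]_(n * n) |
         Num.max (x ij.1 0 + x ij.2 0 - 1) 0 <= vec_mx v ij.1 ij.2] `&`
       [set v | vec_mx v ij.1 ij.2 <= Num.min (x ij.1 0) (x ij.2 0)])).
    apply: closed_bigI => -[i j] _; apply: closedI.
      by apply: closed_ge_fun; exact: cX.
    by apply: closed_le_fun; exact: cX.
  have c3 : closed (\bigcap_(u in [set: 'cV[R]_n])
      [set v : 'rV[R]_(n * n) |
        0 <= (u^T *m (vec_mx v - x *m x^T) *m u) 0 0]).
    by apply: closed_bigI => u _; apply: closed_ge_fun; exact: cquad.
  move: (closedI (closedI c1 c2) c3); congr (closed _).
  apply/esym/seteqP; split => v /=.
    move=> /[dup] Av [[_ _ bX] [_ pX]]; split; [split|] => [[i j]|[i j]|u] /= h.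
    - by rewrite (Asym _ Av) subrr.
    - by have /andP[] := bX _ _ h.
    - exact: pX.
  move=> [[sX bX] pX].
  have sX' i j : vec_mx v i j = vec_mx v j i.
    apply/eqP; rewrite eq_le -subr_ge0 (sX (j, i))//=.
    by rewrite -subr_ge0 (sX (i, j)).
  split; [split => //|split] => [|i j ij||u] /=.
  - exact/symmetricmxP.
  - by have [/= -> ->] := bX (i, j) ij.
  - apply/symmetricmxP => i j; rewrite !mxE !big_ord1 !mxE.
    by have := sX' i j; rewrite !mxE => ->; rewrite [x j 0 * _]mulrC.
  - exact: pX.
have kA : compact A.
  have kB : compact [set v : 'rV[R]_(n * n) | forall k, v ord0 k \in `[(0 : R), 1]].
    apply: (@rV_compact R _ (fun=> `[(0 : R), 1]%classic)).
    by move=> _; exact: segment_compact.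
  apply: (subclosed_compact cA kB).
  move=> v Av k /=; case/mxvec_indexP: k => i j.
  have -> : v ord0 (mxvec_index i j) = vec_mx v i j by rewrite mxE.
  wlog ij : i j / (i <= j)%N.
    by move=> h; case: (leqP i j) => [/h//|/ltnW/h]; rewrite (Asym _ Av).
  case: Av => [[_ _ /(_ _ _ ij)/andP[]]] + + _.
  rewrite ge_max le_min => /andP[_ h0] /andP[h1 _].
  by rewrite in_itv/= h0 (le_trans h1)//; have /andP[] := Fx i.
have A0 : A !=set0.
  by exists (mxvec (x *m x^T)); rewrite /A /= mxvecK; exact: F_RS_outer.
have [v /set_mem Av vmin] := compact_EVT_min A0 kA (continuous_subspaceT cf).
have vlb : lbound [set RS_obj Q c x X | X in [set X | F_RS (x, X)]]
    (RS_obj Q c x (vec_mx v)).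
  move=> _ [Y FY <-]; have := vmin (mxvec Y).
  by rewrite /f mxvecK; apply; apply/mem_set; rewrite /A /= mxvecK.
have -> : ell_RS Q c x = RS_obj Q c x (vec_mx v).
  apply/eqP; rewrite eq_le; apply/andP; split.
    by apply: ge_inf; [exists (RS_obj Q c x (vec_mx v))|exists (vec_mx v)].
  by apply: lb_le_inf => //; exists (RS_obj Q c x (vec_mx v)), (vec_mx v).
exists (vec_mx v) => //; split=> // Y FY.
by apply: vlb; exists Y.
Qed.

End ell_RS_attained.

(* Main.v *)
Require Import Defs.
From mathcomp Require Import all_boot all_order all_algebra.
From mathcomp Require Import all_classical all_reals all_analysis.
From mathcomp Require Import ring lra.

(** By [ell_RS_min] the relaxed value at [x] is the objective of some feasible
    [X], and [x *m x^T] is itself feasible with objective [q Q c x]. Hence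
    [ell_RS Q c x = q Q c x] as soon as [0 <= <Q, X - x x^T>] for every feasible
    [X], which is [ell_RS_eq].

    The matrix [D = X - x x^T] is positive semidefinite. Symmetric elimination
    writes it as a sum of squares [d d^T] (up to positive factors) in which every
    vector [d] vanishes on the indices with [D i i = 0]. So [<Q, D>] is
    nonnegative whenever the form of [Q] is nonnegative on vectors vanishing
    there ([frob_psd_ge0]). If [Q] is positive semidefinite this is immediate.

    For a local minimizer two facts match. The constraint [X i i <= x i] makes
    [D i i] vanish at every [i] with [x i] equal to [0] or [1]
    ([F_RS_diag_eq0]). And the second-order necessary condition makes the form
    of [Q] nonnegative on all vectors supported on the remaining coordinates,
    since both signs of a small step along such a vector stay in the box
    ([local_min_qform_ge0]). *)

Set Implicit Arguments.
Unset Strict Implicit.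
Unset Printing Implicit Defensive.

Import Order.TTheory GRing.Theory Num.Theory.
Import numFieldNormedType.Exports.
Local Open Scope classical_set_scope.
Local Open Scope ring_scope.

(** * Positive semidefinite matrices *)

(** The nonnegative form of [D], evaluated at [v] minus [t] times the [i]-th
    basis vector: a quadratic polynomial in [t], used below for well-chosen
    [t]. *)
Lemma psd_shift (R : realType) n (D : 'M[R]_n) i (v : 'cV[R]_n) t : psd D ->
  0 <= (v^T *m D *m v) 0 0 - 2 * t * (v^T *m col i D) 0 0 + t ^+ 2 * D i i.
Proof.
move=> [/symmetricmxP sD pD]; have := pD (v - t *: delta_mx i 0).
have vDe : v^T *m D *m delta_mx i 0 = v^T *m col i D by rewrite -mulmxA -colE.
have eDv : (delta_mx i 0)^T *m D *m v = v^T *m col i D.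
  rewrite trmx_delta -rowE; apply/matrixP => a b; rewrite !mxE !ord1.
  by apply: eq_bigr => k _; rewrite !mxE sD mulrC.
have eDe : (delta_mx i 0)^T *m D *m delta_mx i 0 = (D i i)%:M :> 'M[R]_1.
  by rewrite trmx_delta -rowE -colE; apply/matrixP => a b; rewrite !mxE !ord1.
rewrite [(v - _)^T]linearB /= [(t *: _)^T]linearZ /=.
rewrite !(mulmxBl, mulmxBr) -!scalemxAl -!scalemxAr.
rewrite vDe eDv eDe; move: (v^T *m D *m v) (v^T *m col i D) => a b.
by rewrite !mxE /= mulr1n; congr (_ <= _); ring.
Qed.

Lemma psd_diag_ge0 (R : realType) n (D : 'M[R]_n) i : psd D -> 0 <= D i i.
Proof.
move=> /(@psd_shift _ _ _ i 0 1).
by rewrite trmx0 !mul0mx !mxE mulr0 subrr add0r expr1n mul1r.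
Qed.

(** If [D i i = 0] the polynomial of [psd_shift] is affine in [t], so that its
    slope, a multiple of [D j i] for [v] the [j]-th basis vector, is zero. *)
Lemma psd_diag0 (R : realType) n (D : 'M[R]_n) i : psd D -> D i i = 0 ->
  forall j, D j i = 0.
Proof.
move=> pD Dii j; apply/eqP; apply/negPn/negP => Dji.
(* at this [t] the polynomial takes the value -1 *)
have := psd_shift i (delta_mx j 0) ((D j j + 1) / (2 * D j i)) pD.
rewrite Dii mulr0 addr0 trmx_delta -!rowE -colE !mxE.
have -> : D j j - 2 * ((D j j + 1) / (2 * D j i)) * D j i = - 1.
  by field.
by rewrite oppr_ge0 ler10.
Qed.

(** One step of symmetric elimination. The form of the result at [v] is the
    minimum over [t] of the polynomial of [psd_shift]. *)
Lemma psd_elim (R : realType) n (D : 'M[R]_n) i : psd D -> D i i != 0 ->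
  psd (D - (D i i)^-1 *: (col i D *m (col i D)^T)).
Proof.
move=> pD Di0; split.
  apply/symmetricmxP => j k; have /symmetricmxP sD := pD.1.
  by rewrite !mxE !big_ord1 !mxE (sD j k) [D j i * _]mulrC.
move=> v; have := psd_shift i v ((v^T *m col i D) 0 0 / D i i) pD.
rewrite mulmxBr mulmxBl -scalemxAr -scalemxAl.
have -> : v^T *m (col i D *m (col i D)^T) *m v
    = ((v^T *m col i D) 0 0 ^+ 2)%:M :> 'M[R]_1.
  have -> : v^T *m (col i D *m (col i D)^T) *m v
      = (v^T *m col i D) *m (v^T *m col i D)^T.
    by rewrite trmx_mul trmxK !mulmxA.
  by apply/matrixP => a b; rewrite mxE big_ord1 !mxE !ord1 expr2.
move: (v^T *m D *m v) (v^T *m col i D) => a b.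
by rewrite !mxE /= mulr1n; congr (_ <= _); field.
Qed.

Lemma frob_outer (R : realType) n (Q : 'M[R]_n) (u v : 'cV[R]_n) :
  frob Q (u *m v^T) = (u^T *m Q *m v) 0 0.
Proof.
rewrite /frob mulmxA mxtrace_mulC mulmxA /mxtrace big_ord1.
by rewrite -(trmxK (_ *m u)) mxE !trmx_mul !trmxK mulmxA.
Qed.

(** Pairing of a positive semidefinite [D] with a matrix whose form is
    nonnegative on the vectors vanishing wherever the diagonal of [D] does.
    Eliminating an index [i] splits off a multiple of the outer square of
    [col i D], a vector of this kind by [psd_diag0], and leaves a matrix with
    fewer nonzero diagonal entries. *)
Lemma frob_psd_ge0 (R : realType) n (Q D : 'M[R]_n) : psd D ->
  (forall v : 'cV[R]_n, (forall i, D i i = 0 -> v i 0 = 0) ->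
    0 <= (v^T *m Q *m v) 0 0) ->
  0 <= frob Q D.
Proof.
have [k] := ubnP #|[pred i | D i i != 0]|; elim: k D => // k IHk D ltDk pD pQ.
have [i Di0|D0] := pickP [pred i | D i i != 0]; last first.
  have -> : D = 0.
    apply/matrixP => j i; rewrite mxE (psd_diag0 pD)//.
    by apply/eqP; have /negbFE := D0 i.
  by rewrite /frob mulmx0 linear0.
have {}Di0 : D i i != 0 by [].
set d := col i D; pose D' := D - (D i i)^-1 *: (d *m d^T).
have /symmetricmxP sD := pD.1.
have d0 j : D j j = 0 -> d j 0 = 0.
  by move=> Djj; rewrite mxE sD (psd_diag0 pD Djj).
have D'E j : D' j j = D j j - (D i i)^-1 * (d j 0 * d j 0).
  by rewrite !mxE big_ord1 !mxE.
have D'0 j : D j j = 0 -> D' j j = 0.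
  by move=> Djj; rewrite D'E d0 // Djj !mulr0 subr0.
have -> : frob Q D = frob Q D' + (D i i)^-1 * frob Q (d *m d^T).
  rewrite /frob -mxtraceZ -mxtraceD scalemxAr -mulmxDr.
  by rewrite /D' subrK.
apply: addr_ge0; last first.
  by rewrite mulr_ge0 ?invr_ge0 ?psd_diag_ge0// frob_outer; apply: pQ.
apply: IHk.
- rewrite -ltnS; apply: leq_trans ltDk; rewrite ltnS; apply: proper_card.
  apply/properP; split.
    by apply/fintype.subsetP => j; rewrite !inE; apply: contra_neq; exact: D'0.
  by exists i; rewrite !inE // D'E mxE mulKf // subrr eqxx.
- exact: psd_elim.
- by move=> v v0; apply: pQ => j /D'0; exact: v0.
Qed.

(** * Exactness of the relaxation *)

Lemma ell_RS_eq (R : realType) n (Q : 'M[R]_n) (c x : 'cV[R]_n) : F x ->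
  (forall X, F_RS (x, X) -> 0 <= frob Q (X - x *m x^T)) ->
  ell_RS Q c x = q Q c x.
Proof.
move=> Fx h; have [X FX [eX minX]] := ell_RS_min Q c Fx.
have qE : RS_obj Q c x (x *m x^T) = q Q c x by rewrite /RS_obj frob_outer.
apply/eqP; rewrite eq_le -{1}qE minX; last exact: F_RS_outer.
have := h X FX; rewrite /frob mulmxBr linearB subr_ge0 -!/(frob _ _) => le_fr.
by rewrite -eX -qE /RS_obj lerD2r ler_pM2l // invr_gt0.
Qed.

(** At [x i = 0] or [x i = 1] the bounds [x i ^+ 2 <= X i i <= x i] coincide. *)
Lemma F_RS_diag_eq0 (R : realType) n (x : 'cV[R]_n) X i : F_RS (x, X) ->
  ~~ (0 < x i 0 < 1) -> (X - x *m x^T) i i = 0.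
Proof.
move=> [[_ Fx bX] pX] /= xi; have := psd_diag_ge0 i pX.
have /andP[_] := bX i i (leqnn i); rewrite /= minxx.
have : x i 0 * x i 0 = x i 0.
  have /andP[x0 x1] := Fx i; move: xi.
  rewrite !lt_neqAle x0 x1 !andbT negb_and !negbK.
  by case/orP => /eqP; [move<-; rewrite mulr0|move->; rewrite mulr1].
rewrite !mxE big_ord1 !mxE => -> le1 le2.
by apply/eqP; rewrite eq_le le2 subr_le0 le1.
Qed.

Lemma q_parallelogram (R : realType) n (Q : 'M[R]_n) (c x w : 'cV[R]_n) :
  q Q c (x + w) + q Q c (x - w) = 2 * q Q c x + (w^T *m Q *m w) 0 0.
Proof.
rewrite /q !linearD !linearN /= !(mulmxDl, mulmxDr, mulNmx, mulmxN).
move: (x^T *m Q *m x) (x^T *m Q *m w) (w^T *m Q *m x) (w^T *m Q *m w).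
move=> A B C E.
by move: (c^T *m x) (c^T *m w) => a b; rewrite !mxE; field.
Qed.

Lemma near_F_segment (R : realType) n (x v : 'cV[R]_n) : F x ->
  (forall i, ~~ (0 < x i 0 < 1) -> v i 0 = 0) ->
  \forall t \near (0 : R), F (x + t *: v).
Proof.
move=> Fx v0.
suff H i : \forall t \near (0 : R), 0 <= (x + t *: v) i 0 <= 1.
  exact: filter_forall H.
have [/andP[xi0 xi1]|/v0 vi] := boolP (0 < x i 0 < 1); last first.
  by near=> t; rewrite !mxE vi mulr0 addr0; exact: Fx.
have ct : x i 0 + t * v i 0 @[t --> (0 : R)] --> x i 0.
  rewrite -[X in _ --> X]addr0 -[X in _ --> _ + X](mul0r (v i 0)).
  by apply: cvgD; [exact: cvg_cst|apply: cvgM; [exact: cvg_id|exact: cvg_cst]].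
near=> t; rewrite !mxE; apply/andP; split; apply: ltW; near: t.
  exact: (cvgr_gt _ ct).
exact: (cvgr_lt _ ct).
Unshelve. all: by end_near. Qed.

(** Second-order necessary condition. Along a direction [v] moving only
    coordinates interior to the box, both [x + t v] and [x - t v] are feasible
    and near [x] for some [t != 0]; adding the two inequalities of local
    minimality cancels the first-order term. *)
Lemma local_min_qform_ge0 (R : realType) n (Q : 'M[R]_n) (c x v : 'cV[R]_n) :
  boxqp_local_min Q c x -> (forall i, ~~ (0 < x i 0 < 1) -> v i 0 = 0) ->
  0 <= (v^T *m Q *m v) 0 0.
Proof.
move=> [Fx minx] v0.
have line (w : 'cV[R]_n) : (forall i, ~~ (0 < x i 0 < 1) -> w i 0 = 0) ->
    \forall t \near (0 : R), q Q c x <= q Q c (x + t *: w).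
  move=> w0.
  have ct : x + t *: w @[t --> (0 : R)] --> x.
    have cw : t *: w @[t --> (0 : R)] --> (0 : R) *: w.
      exact: scalel_continuous.
    by have := cvgD (cvg_cst x) cw; rewrite scale0r addr0; exact.
  have := ct _ minx; rewrite /= => minx'.
  near=> t; have : F (x + t *: w) by near: t; exact: near_F_segment.
  by near: t.
have [t t0 [le1 le2]] : exists2 t : R, t != 0 &
    q Q c x <= q Q c (x + t *: v) /\ q Q c x <= q Q c (x - t *: v).
  have lineN := line (- v) (fun i xi => ltac:(by rewrite mxE v0 // oppr0)).
  have : \forall t \near (0 : R)^'+, t != 0 /\
      q Q c x <= q Q c (x + t *: v) /\ q Q c x <= q Q c (x - t *: v).
    near=> t; split; first by apply: lt0r_neq0; near: t; exact: nbhs_right_gt.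
    split; first by near: t; apply: cvg_within; exact: line.
    by rewrite -scalerN; near: t; apply: cvg_within.
  by move=> /filter_ex[t [t0 ?]]; exists t.
have := q_parallelogram Q c x (t *: v).
rewrite [(t *: v)^T]linearZ /= -!scalemxAl -scalemxAr scalerA mxE => e.
have : 0 <= t * t * (v^T *m Q *m v) 0 0 by lra.
by rewrite pmulr_rge0 // -expr2 exprn_even_gt0.
Unshelve. all: by end_near. Qed.

Theorem corollary3p2 (R : realType) (n : nat) (n_ge1 : (1 <= n)%N)
    (Q : 'M[R]_n) (c : 'cV[R]_n) (Q_sym : Q \is symmetricmx) :
  (psd Q -> forall xhat : 'cV[R]_n, F xhat -> ell_RS Q c xhat = q Q c xhat) /\
  (forall xhat : 'cV[R]_n,
     boxqp_local_min Q c xhat \/ boxqp_global_min Q c xhat ->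
     ell_RS Q c xhat = q Q c xhat).
Proof.
split=> [[_ pQ] x Fx|x minx].
  by apply: ell_RS_eq => // X [_ pX]; apply: frob_psd_ge0 => // v _; exact: pQ.
have {minx} locx : boxqp_local_min Q c x.
  by case: minx => // -[Fx minx]; split=> //; near=> y; apply: minx; near: y; exact: withinT.
apply: ell_RS_eq => [|X FX]; first exact: locx.1.
apply: frob_psd_ge0; first exact: FX.2.
move=> v v0; apply: (local_min_qform_ge0 locx) => i xi.
by apply: v0; exact: F_RS_diag_eq0 FX xi.
Unshelve. all: by end_near. Qed.
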